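(* There are absolute constants $c>0$ and $H_0$ such that, for every integer $H\ge H_0$, every $\epsilon\in\{1,2\}$, every $r\in\{1,\dots,H\}$, and every partition $L\sqcup U=\{1,\dots,H\}\setminus\{r\}$ (the parts $L,U$ are disjoint and may be arbitrary), with $N=2H+\epsilon$ and $$J=\{0\}\cup L\cup\{N-u:u\in U\}\subseteq\mathbb Z,$$ one has $$P_N(J)\ge cH^2 .$$
   Context: Let $T=N+2$. For a finite set $J\subseteq\mathbb Z$ and an integer $d\ge 1$, put $$A_d(J)=\#\{(x,y)\in J^2: x-y=d\},\qquad B_d(J)=\#\{(x,y)\in J^2: x+y=d-1\},$$ where the equations are in ordinary integers and pairs are ordered, and $$P_N(J)=\sum_{d=1}^{N+1}\bigl(A_d(J)+B_d(J)\bigr)\bigl(A_{T-d}(J)+B_{T-d}(J)\bigr).$$ *)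

(* Defs.v *)
From mathcomp Require Import all_boot all_order all_algebra finmap reals.

Set Implicit Arguments.
Unset Strict Implicit.
Unset Printing Implicit Defensive.

Import Order.TTheory GRing.Theory Num.Theory.

Local Open Scope fset_scope.
Local Open Scope ring_scope.

Definition diff_count (J : {fset int}) (d : nat) : nat :=
  #|` [fset p in J `*` J | p.1 - p.2 == d%:Z] |.

(* The right-hand side is the integer d - 1, not the truncated predecessor. *)
Definition sum_count (J : {fset int}) (d : nat) : nat :=
  #|` [fset p in J `*` J | p.1 + p.2 == d%:Z - 1] |.

(* Here d ranges over 1, ..., N + 1, so that T - d = N + 2 - d is never
   truncated. *)
Definition pair_energy (N : nat) (J : {fset int}) : nat :=
  (\sum_(1 <= d < N.+2)
     (diff_count J d + sum_count J d)
     * (diff_count J (N + 2 - d) + sum_count J (N + 2 - d)))%N.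

Definition folded_set (N : nat) (L U : {fset nat}) : {fset int} :=
  [fset 0] `|` [fset l%:Z | l in L] `|` [fset N%:Z - u%:Z | u in U].

(* Main.v *)
(* Colour x in [1, H] by L or U (the exceptional r counts as U). Since 0 is in J,
   every pair of J whose difference or shifted sum is d contributes to P_N as
   soon as N + 1 - d is in J, so P_N dominates, up to a constant factor and O(H),
   the number of "closing" pairs (x, y), i.e. of one of the colour patterns
     z = x + y + 1: UUU, LUL;   z = x + y: LLU;
     z = N - x - y: LLL;        z = N - 1 - x - y: UUL.
   It remains to see that any 2-colouring has >> H^2 closing pairs. Suppose not.
   If u is in U, then (1) for almost all b, writing c = N - 1 - u - b = b + d + 1,
   b and c have the same colour (no UUL), hence d = N - 2 - u - 2b is in L (no UUU,
   no LUL), and then N - 1 - 2b = u + d + 1 is in U (no LUL).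
   The triples of sum N with entries near 2H/3 are almost never LLL, so U has
   positive density near 2H/3, and almost all numbers of the form m = N - 1 - 2b
   in a suitable range are in U.
   Apply (1) with such an m in the role of u: the numbers d < m which are then
   forced into L are all odd. If N is even, one of them is another m' in U;
   if N is odd, m is the sum of two of them, which contradicts LLU. *)
Require Import Defs.
From mathcomp Require Import all_boot all_order all_algebra finmap reals.
From mathcomp Require Import zify.

Set Implicit Arguments.
Unset Strict Implicit.
Unset Printing Implicit Defensive.

Import Order.TTheory GRing.Theory Num.Theory.
Local Open Scope fset_scope.
Local Open Scope ring_scope.

(** * Counting by injections *)

Section Counting.
Local Open Scope nat_scope.

(** Charge each element of [s] to the first map of [fs] that sends it into [t]; by injectivity each
    map is charged at most [size t] times. *)
Lemma size_cover (T1 T2 : eqType) (s : seq T1) (t : seq T2)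
    (fs : seq (T1 -> T2)) :
  uniq s ->
  (forall f, List.In f fs -> {in s &, injective f}) ->
  {in s, forall p, has (fun f => f p \in t) fs} ->
  size s <= size fs * size t.
Proof.
elim: fs s => [|f fs IH] s us injf cov.
  by case: s us injf cov => // p s _ _ /(_ p (mem_head _ _)).
rewrite -(count_predC (fun p => f p \in t) s) mulSn leq_add //.
  rewrite -size_filter -(size_map f); apply: uniq_leq_size.
    rewrite map_inj_in_uniq ?filter_uniq // => p q.
    rewrite !mem_filter => /andP[_ ps] /andP[_ qs].
    by apply: injf => //; left.
  by move=> x /mapP[p]; rewrite mem_filter => /andP[ft _] ->.
rewrite -size_filter; apply: IH; first exact: filter_uniq.
  move=> g gs p q; rewrite !mem_filter => /andP[_ ps] /andP[_ qs].
  by apply: injf => //; right.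
move=> p; rewrite mem_filter => /andP[/= /negbTE nft /cov].
by rewrite /= nft.
Qed.

Definition pairs (s t : seq nat) := [seq (x, y) | x <- s, y <- t].

Lemma mem_pairs s t p : (p \in pairs s t) = (p.1 \in s) && (p.2 \in t).
Proof.
apply/allpairsP/andP => [[[x y] [xs yt ->]]|[xs yt]] //.
by exists p; split=> //; case: p {xs yt}.
Qed.

Lemma uniq_pairs s t : uniq s -> uniq t -> uniq (pairs s t).
Proof. by move=> us ut; apply: allpairs_uniq => // -[? ?] [? ?]. Qed.

Lemma size_pairs s t : size (pairs s t) = size s * size t.
Proof. exact: size_allpairs. Qed.

(** * Closing pairs and the colours forced in their absence *)

Section Closing.
Variables (l : pred nat) (H N : nat).

(* The letters are the colours of x, y and z; x and y may be taken
   anywhere in [1, H], while z must be checked to lie there. *)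
Definition UUU x y :=
  [&& 0 < x + y + 1 <= H, ~~ l x, ~~ l y & ~~ l (x + y + 1)].
Definition LLU x y := [&& 0 < x + y <= H, l x, l y & ~~ l (x + y)].
Definition LUL x y :=
  [&& 0 < x + y + 1 <= H, l x, ~~ l y & l (x + y + 1)].
Definition LLL x y :=
  [&& 0 < N - (x + y) <= H, l x, l y & l (N - (x + y))].
Definition UUL x y :=
  [&& 0 < N - (x + y + 1) <= H, ~~ l x, ~~ l y & l (N - (x + y + 1))].

Definition closing (p : nat * nat) :=
  [&& 0 < p.1 <= H, 0 < p.2 <= H &
   [|| UUU p.1 p.2, LLU p.1 p.2, LUL p.1 p.2, LLL p.1 p.2 | UUL p.1 p.2]].

Definition closing_pairs := [seq p <- pairs (iota 1 H) (iota 1 H) | closing p].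

Lemma mem_closing p : (p \in closing_pairs) = closing p.
Proof.
rewrite mem_filter mem_pairs !mem_iota /closing !add1n !ltnS.
by case: (0 < p.1 <= H); case: (0 < p.2 <= H); rewrite ?andbF ?andbT.
Qed.

(* [b] and [c] are exchanged by the reflection b -> N - 1 - u - b. *)
Lemma reflection_forces u b c d :
    0 < u <= H -> 0 < b <= H -> 0 < c <= H -> 0 < d ->
    c = b + d + 1 -> N = u + b + c + 1 -> ~~ l u ->
  [|| closing (u, b), closing (u, c), closing (b, d) | l d].
Proof.
move=> hu hb hc hd ec eN nlu.
have e1 : N - (u + b + 1) = c by lia.
have e2 : N - (u + c + 1) = b by lia.
have hd' : 0 < d <= H by lia.
rewrite /closing /UUU /LLU /LUL /LLL /UUL /= e1 e2 -ec hu hb hc hd' nlu.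
by case: (l b); case: (l c); case: (l d); rewrite /= ?orbT.
Qed.

Lemma LUL_forces x y z :
    0 < x -> 0 < y -> z = x + y + 1 -> z <= H -> l x -> ~~ l y -> l z ->
  closing (x, y).
Proof.
move=> x0 y0 ez zH lx nly lz; rewrite /closing /LUL /= -ez lx nly lz /=.
have -> : 0 < x <= H by lia.
have -> : 0 < y <= H by lia.
have -> : 0 < z <= H by lia.
by rewrite !orbT.
Qed.

Lemma LLU_forces x y z :
    0 < x -> 0 < y -> z = x + y -> z <= H -> l x -> l y -> ~~ l z ->
  closing (x, y).
Proof.
move=> x0 y0 ez zH lx ly nlz; rewrite /closing /LLU /= -ez lx ly nlz /=.
have -> : 0 < x <= H by lia.
have -> : 0 < y <= H by lia.
have -> : 0 < z <= H by lia.
by rewrite !orbT.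
Qed.

(** * Every colouring has quadratically many closing pairs *)

Section Supersaturation.
Variables (M : nat).
(** At this scale both [N / 3] and [2H / 3] are [16 * M] up to a constant; [200 <= M] absorbs such
    rounding errors. *)
Hypotheses (M_ge : 200 <= M) (H_ge : 24 * M <= H) (H_lt : H < 24 * M + 24).
Hypotheses (N_gt : 2 * H < N) (N_le : N <= 2 * H + 2).

Let g := size closing_pairs.
(* [W] is U near 2H/3; [X s] is the exceptional set, where N - 1 - 2b is in L. *)
Let W := [seq u <- iota (14 * M) (3 * M) | ~~ l u].
Let X s := [seq b <- iota s M | l (N - (2 * b + 1))].

(** For [a], [b] in [[16M, 17M)], either [(a, b)] closes as LLL or one of [a], [b], [N - (a + b)]
    lies in [W]. Each of these three cases embeds into [W] times an interval of length [M]. *)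
Lemma middle_U_dense : M * M <= g + 3 * (size W * M).
Proof.
pose S := pairs (iota (16 * M) M) (iota (16 * M) M).
have uS : uniq S by apply: uniq_pairs; exact: iota_uniq.
have memS p : p \in S -> (16 * M <= p.1 < 17 * M) && (16 * M <= p.2 < 17 * M).
  by rewrite mem_pairs !mem_iota; lia.
have <- : size S = M * M by rewrite size_pairs !size_iota.
rewrite -(count_predC closing S) leq_add //.
  rewrite -size_filter; apply: uniq_leq_size; first exact: filter_uniq.
  by move=> p; rewrite mem_filter mem_closing => /andP[].
pose T := pairs W (iota (16 * M) M).
have -> : size W * M = size T by rewrite size_pairs size_iota.
rewrite -size_filter.
pose fs := [:: (fun p => (p.1, p.2)); (fun p => (p.2, p.1));
               (fun p => (N - (p.1 + p.2), p.1))] : seq (nat * nat -> _).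
apply: (@size_cover _ _ _ _ fs).
- exact: filter_uniq.
- move=> f hf [a b] [a' b']; rewrite !mem_filter.
  move=> /andP[_ /memS /= hab] /andP[_ /memS /= hab'].
  by case: hf => [<-|[<-|[<-|//]]] /= [] *; congr pair; lia.
- move=> [a b]; rewrite mem_filter => /andP[/= + /memS /= hab].
  rewrite /closing /T /= !mem_pairs !mem_filter !mem_iota /=.
  have -> : 0 < a <= H by lia.
  have -> : 0 < b <= H by lia.
  have h1 : 0 < N - (a + b) <= H by lia.
  have h2 : 14 * M <= N - (a + b) < 14 * M + 3 * M by lia.
  have h3 : 14 * M <= a < 14 * M + 3 * M by lia.
  have h4 : 14 * M <= b < 14 * M + 3 * M by lia.
  have h5 : 16 * M <= a < 16 * M + M by lia.
  have h6 : 16 * M <= b < 16 * M + M by lia.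
  rewrite /LLL h1 h2 h3 h4 h5 h6.
  by case: (l a); case: (l b); case: (l _); rewrite /= ?orbT.
Qed.

(** If the three pairs of the reflection of [b] in [u] do not close, then [d] is in L; since
    [d + u + 1 = N - 1 - 2b] is in L as well, [(d, u)] closes as LUL. Hence four maps. *)
Lemma reflection_exceptions s : 13 * M <= s <= 14 * M -> size W * size (X s) <= 4 * g.
Proof.
move=> hs; rewrite -size_pairs.
have memS p : p \in pairs W (X s) -> [&& 14 * M <= p.1 < 17 * M, ~~ l p.1,
    13 * M <= p.2 < 15 * M & l (N - (2 * p.2 + 1))].
  rewrite mem_pairs !mem_filter !mem_iota.
  move=> /andP[/andP[h1 h2] /andP[h3 h4]].
  by apply/and4P; split => //; lia.
pose fs := [:: (fun p => (p.1, p.2)); (fun p => (p.1, N - (p.1 + p.2 + 1)));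
               (fun p => (p.2, N - (p.1 + 2 * p.2 + 2)));
               (fun p => (N - (p.1 + 2 * p.2 + 2), p.1))]
  : seq (nat * nat -> _).
apply: (@size_cover _ _ _ _ fs).
- by apply: uniq_pairs; rewrite filter_uniq ?iota_uniq.
- move=> f hf [u b] [u' b'] /memS /= /and4P[h1 _ h2 _].
  move=> /memS /= /and4P[h3 _ h4 _].
  by case: hf => [<-|[<-|[<-|[<-|//]]]] /= [] *; congr pair; lia.
- move=> [u b] /memS /= /and4P[h1 nlu h2 lm]; rewrite !mem_closing.
  pose d := N - (u + 2 * b + 2); pose c := N - (u + b + 1).
  have: [|| closing (u, b), closing (u, c), closing (b, d) | l d].
    by apply: reflection_forces; rewrite // /c /d; lia.
  case/or4P => [->|->|->|ld]; rewrite ?orbT //.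
  by rewrite (@LUL_forces d u (N - (2 * b + 1))) ?orbT // /d; lia.
Qed.

Lemma size_X_complement s :
  size [seq b <- iota s M | ~~ l (N - (2 * b + 1))] = M - size (X s).
Proof.
rewrite !size_filter -{2}(size_iota s M).
by rewrite -(count_predC (fun b => l (N - (2 * b + 1)))) addKn.
Qed.

(** Two numbers [N - 1 - 2b] in U, taken from disjoint ranges, serve as [u] and [d] of one
    reflection. As [d] is not in L, one of its three pairs closes. *)
Lemma even_reflections :
  ~~ odd N -> (M - size (X (13 * M))) * (M - size (X (14 * M))) <= 3 * g.
Proof.
move=> evN; have eN : N = 2 * H + 2 by lia.
rewrite -!size_X_complement -size_pairs.
set S := pairs _ _.
have memS p : p \in S -> [&& 13 * M <= p.1 < 14 * M, 14 * M <= p.2 < 15 * M,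
    ~~ l (N - (2 * p.1 + 1)) & ~~ l (N - (2 * p.2 + 1))].
  rewrite mem_pairs !mem_filter !mem_iota.
  move=> /andP[/andP[h1 h2] /andP[h3 h4]].
  by apply/and4P; split => //; lia.
pose m (b : nat) := N - (2 * b + 1).
(* The solution of [m p.1 + 2 * b + m p.2 + 2 = N], integral because [N] is even. *)
pose b p : nat := p.1 + p.2 - (H + 1).
pose fs := [:: (fun p => (m p.1, b p)); (fun p => (m p.1, b p + m p.2 + 1));
               (fun p => (b p, m p.2))]
  : seq (nat * nat -> _).
apply: (@size_cover _ _ _ _ fs).
- by apply: uniq_pairs; rewrite filter_uniq ?iota_uniq.
- move=> f hf [x y] [x' y'] /memS /= /and4P[h1 h2 _ _].
  move=> /memS /= /and4P[h3 h4 _ _].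
  by case: hf => [<-|[<-|[<-|//]]]; rewrite /m /b /= => -[] *;
    congr pair; lia.
- move=> [x y] /memS /= /and4P[h1 h2 n1 n2]; rewrite !mem_closing orbF.
  have : [|| closing (m x, b (x, y)), closing (m x, b (x, y) + m y + 1),
             closing (b (x, y), m y) | l (m y)].
    by apply: reflection_forces; rewrite // /m /b /=; lia.
  by rewrite (negbTE n2) orbF.
Qed.

(** Two reflections in the same [m] in U force two numbers into L whose sum is [m], an LLU pair. The
    count 7 is three pairs per reflection plus this one. *)
Lemma odd_reflections : odd N -> (M - size (X (13 * M))) * M <= 7 * g.
Proof.
move=> oddN; have eN : N = 2 * H + 1 by lia.
pose S := pairs [seq x <- iota (13 * M) M | ~~ l (N - (2 * x + 1))]
                (iota (7 * M) M).
have <- : size S = (M - size (X (13 * M))) * M.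
  by rewrite size_pairs size_X_complement size_iota.
have memS p : p \in S -> [&& 13 * M <= p.1 < 14 * M, 7 * M <= p.2 < 8 * M
    & ~~ l (N - (2 * p.1 + 1))].
  rewrite mem_pairs !mem_filter !mem_iota.
  by move=> /andP[/andP[h1 h2] h3]; apply/and3P; split => //; lia.
pose m (p : nat * nat) := N - (2 * p.1 + 1).
(* [b'] is chosen so that [e p.1 p.2 + e p.1 (b' p) = m p]. *)
pose b' (p : nat * nat) := 3 * p.1 - p.2 - (H + 1).
pose e (x b : nat) := 2 * x - 2 * b - 1.
pose fs := [:: (fun p => (m p, p.2)); (fun p => (m p, p.2 + e p.1 p.2 + 1));
               (fun p => (p.2, e p.1 p.2));
               (fun p => (m p, b' p)); (fun p => (m p, b' p + e p.1 (b' p) + 1));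
               (fun p => (b' p, e p.1 (b' p)));
               (fun p => (e p.1 p.2, e p.1 (b' p)))]
  : seq (nat * nat -> _).
apply: (@size_cover _ _ _ _ fs).
- by apply: uniq_pairs; rewrite ?filter_uniq ?iota_uniq.
- move=> f hf [x y] [x' y'] /memS /= /and3P[h1 h2 _].
  move=> /memS /= /and3P[h3 h4 _].
  by case: hf => [<-|[<-|[<-|[<-|[<-|[<-|[<-|//]]]]]]];
    rewrite /m /b' /e /= => -[] *; congr pair; lia.
- move=> [x y] /memS /= /and3P[h1 h2 n1]; rewrite !mem_closing orbF.
  set z := b' (x, y); set w := m (x, y).
  have ez : z = 3 * x - y - (H + 1) by [].
  have ew : w = N - (2 * x + 1) by [].
  have e1 : e x y = 2 * x - 2 * y - 1 by [].
  have e2 : e x z = 2 * x - 2 * z - 1 by [].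
  have: [|| closing (w, y), closing (w, y + e x y + 1), closing (y, e x y)
          | l (e x y)].
    by apply: reflection_forces; rewrite // ?ew ?e1; lia.
  case/or4P => [->|->|->|l1]; rewrite ?orbT //.
  have: [|| closing (w, z), closing (w, z + e x z + 1), closing (z, e x z)
          | l (e x z)].
    by apply: reflection_forces; rewrite // ?ew ?e2 ?ez; lia.
  case/or4P => [->|->|->|l2]; rewrite ?orbT //.
  have -> : closing (e x y, e x z).
    apply: (@LLU_forces _ _ w) => //; rewrite ?ew ?e1 ?e2 ?ez //; lia.
  by rewrite ?orbT.
Qed.

Lemma many_closing_pairs : M * M <= 100 * g.
Proof.
have h0 := middle_U_dense.
have h1 : size W * size (X (13 * M)) <= 4 * g by apply: reflection_exceptions; lia.
have h2 : size W * size (X (14 * M)) <= 4 * g by apply: reflection_exceptions; lia.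
rewrite leqNgt; apply/negP => small.
(* If [100 * g < M * M], then [W] has at least [33M / 100] elements, each [X s] at most [12M / 99],
   and its complement at least [4M / 5]. The parity lemmas then give [4 * M * M <= 35 * g] or
   [16 * M * M <= 75 * g], a contradiction. *)
have hw : 99 * M <= 300 * size W by rewrite -(leq_pmul2r (_ : 0 < M)); lia.
have few s : size W * size (X s) <= 4 * g -> 99 * size (X s) <= 12 * M.
  move=> h; rewrite -(leq_pmul2r (_ : 0 < M)); last lia.
  have : (99 * M) * size (X s) <= (300 * size W) * size (X s).
    by rewrite leq_mul2r hw orbT.
  lia.
have {h1} h1 := few _ h1; have {h2} h2 := few _ h2.
have k1 : 4 * M <= 5 * (M - size (X (13 * M))) by lia.
have k2 : 4 * M <= 5 * (M - size (X (14 * M))) by lia.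
case: (boolP (odd N)) => [/odd_reflections|/even_reflections] h.
  have := leq_mul k1 (leqnn M); lia.
have := leq_mul k1 k2; lia.
Qed.

End Supersaturation.
End Closing.
End Counting.

(** * From closing pairs to the energy *)

(** Split [s] by the value [k] of [d]. The images under [f] are distinct pairs counted by the first
    factor at [k], and the second factor is at least 1 because [(0, N + 1 - k)] has sum
    [(N + 2 - k) - 1]. *)
Lemma pair_energy_ge (N : nat) (J : {fset int}) (s : seq (nat * nat))
    (f : nat * nat -> int * int) (d : nat * nat -> nat) :
  uniq s -> {in s &, injective f} ->
  (forall p, p \in s ->
    [/\ (0 < d p < N.+2)%N, (f p).1 \in J /\ (f p).2 \in J,
      (f p).1 - (f p).2 = (d p)%:Z \/ (f p).1 + (f p).2 = (d p)%:Z - 1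
    & 0 \in J /\ N%:Z + 1 - (d p)%:Z \in J]) ->
  (size s <= pair_energy N J)%N.
Proof.
move=> us injf hs.
have -> : size s = (\sum_(1 <= k < N.+2) count (fun p => d p == k) s)%N.
  rewrite -[LHS]sum1_size.
  under [RHS]eq_bigr do rewrite -sum1_count big_mkcond /=.
  rewrite exchange_big /=; apply: eq_big_seq => p /hs[hd _ _ _].
  rewrite (bigD1_seq (d p)) ?iota_uniq //=; last by rewrite mem_index_iota.
  by rewrite eqxx big1 // => i /negbTE; rewrite eq_sym => ->.
rewrite /pair_energy !big_seq; apply: leq_sum => k.
rewrite mem_index_iota => hk.
have [->//|] := posnP (count (fun p => d p == k) s).
rewrite -has_count => /hasP[q /hs[_ _ _ [J0 Jq]] /eqP dq].
rewrite -[leqLHS]muln1; apply: leq_mul; last first.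
  apply: leq_trans (leq_addl _ _); rewrite cardfs_gt0; apply/fset0Pn.
  exists (0, N%:Z + 1 - (d q)%:Z); rewrite !inE /= J0 Jq /= dq.
  by apply/eqP; lia.
rewrite -size_filter -(size_map f).
rewrite /diff_count /sum_count -size_cat; apply: uniq_leq_size.
  rewrite map_inj_in_uniq ?filter_uniq // => x y.
  by rewrite !mem_filter => /andP[_ xs] /andP[_ ys]; exact: injf.
move=> _ /mapP[p + ->]; rewrite mem_filter mem_cat => /andP[/eqP <- /hs].
by case=> _ [f1 f2] + _; rewrite !inE /= f1 f2 /= => -[->|->]; rewrite eqxx ?orbT.
Qed.

Section Folded.
Variables (H N r : nat) (L U : {fset nat}).
Hypotheses (HN : (2 * H < N)%N) (hU : L `|` U = [fset k in iota 1 H | k != r]).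

Let l : pred nat := fun x => x \in L.
Let J := folded_set N L U.
Let Sq := pairs (iota 1 H) (iota 1 H).

Lemma folded_set0 : 0 \in J.
Proof. by rewrite /J /folded_set !inE eqxx. Qed.

Lemma folded_set_low x : l x -> x%:Z \in J.
Proof.
by move=> lx; rewrite /J /folded_set !inE in_imfset ?orbT.
Qed.

Lemma folded_set_high x :
  (0 < x <= H)%N -> x != r -> ~~ l x -> N%:Z - x%:Z \in J.
Proof.
move=> hx xr nlx; have: x \in L `|` U.
  by rewrite hU !inE /= mem_iota xr andbT; lia.
rewrite inE [x \in L](negbTE nlx) /= => xU.
rewrite /J /folded_set !inE; apply/orP; right.
by apply/imfsetP; exists x.
Qed.

(** [l] colours [r] as U although [r] is not in [U], so [folded_set_high] does not cover it. *)
Let avoids x y z := [&& r != x, r != y & r != z].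

(** When [y] is in U, as here and in LUL and UUL, a difference [d = y + 1] is used, and
    [N + 1 - d = N - y] is in [J]. *)
Lemma UUU_count : (size [seq p <- Sq | UUU l H p.1 p.2
    && avoids p.1 p.2 (p.1 + p.2 + 1)] <= pair_energy N J)%N.
Proof.
apply: (@pair_energy_ge _ _ _
  (fun p => (N%:Z - p.1%:Z, N%:Z - (p.1 + p.2 + 1)%:Z)) (fun p => p.2.+1)).
- by rewrite filter_uniq // uniq_pairs ?iota_uniq.
- by move=> [x y] [x' y'] _ _ /= [] *; congr pair; lia.
move=> [x y]; rewrite mem_filter mem_pairs !mem_iota /=.
move=> /andP[/andP[/and4P[hz nx ny nz] /and3P[rx ry rz]] /andP[hx hy]].
split; [lia| |left; lia|split; first exact: folded_set0].
  by split; apply: folded_set_high; rewrite // 1?eq_sym //; lia.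
have -> : N%:Z + 1 - y.+1%:Z = N%:Z - y%:Z by lia.
by apply: folded_set_high; rewrite // 1?eq_sym //; lia.
Qed.

(** When [x] and [y] are in L, as here and in LLL, the sum [x + y = d - 1] is used;
    [N + 1 - d = N - (x + y)] is in [J] as [N - z] here and as [z] in LLL. *)
Lemma LLU_count : (size [seq p <- Sq | LLU l H p.1 p.2
    && avoids p.1 p.2 (p.1 + p.2)] <= pair_energy N J)%N.
Proof.
apply: (@pair_energy_ge _ _ _
  (fun p => (p.1%:Z, p.2%:Z)) (fun p => (p.1 + p.2).+1)).
- by rewrite filter_uniq // uniq_pairs ?iota_uniq.
- by move=> [x y] [x' y'] _ _ /= [] *; congr pair; lia.
move=> [x y]; rewrite mem_filter mem_pairs !mem_iota /=.
move=> /andP[/andP[/and4P[hz lx ly nz] /and3P[rx ry rz]] /andP[hx hy]].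
split; [lia| |right; lia|split; first exact: folded_set0].
  by split; apply: folded_set_low.
have -> : N%:Z + 1 - (x + y).+1%:Z = N%:Z - (x + y)%:Z by lia.
by apply: folded_set_high; rewrite // 1?eq_sym //; lia.
Qed.

Lemma LUL_count : (size [seq p <- Sq | LUL l H p.1 p.2
    && avoids p.1 p.2 (p.1 + p.2 + 1)] <= pair_energy N J)%N.
Proof.
apply: (@pair_energy_ge _ _ _
  (fun p => ((p.1 + p.2 + 1)%:Z, p.1%:Z)) (fun p => p.2.+1)).
- by rewrite filter_uniq // uniq_pairs ?iota_uniq.
- by move=> [x y] [x' y'] _ _ /= [] *; congr pair; lia.
move=> [x y]; rewrite mem_filter mem_pairs !mem_iota /=.
move=> /andP[/andP[/and4P[hz lx ny lz] /and3P[rx ry rz]] /andP[hx hy]].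
split; [lia| |left; lia|split; first exact: folded_set0].
  by split; apply: folded_set_low.
have -> : N%:Z + 1 - y.+1%:Z = N%:Z - y%:Z by lia.
by apply: folded_set_high; rewrite // 1?eq_sym //; lia.
Qed.

Lemma LLL_count : (size [seq p <- Sq | LLL l H N p.1 p.2
    && avoids p.1 p.2 (N - (p.1 + p.2))] <= pair_energy N J)%N.
Proof.
apply: (@pair_energy_ge _ _ _
  (fun p => (p.1%:Z, p.2%:Z)) (fun p => (p.1 + p.2).+1)).
- by rewrite filter_uniq // uniq_pairs ?iota_uniq.
- by move=> [x y] [x' y'] _ _ /= [] *; congr pair; lia.
move=> [x y]; rewrite mem_filter mem_pairs !mem_iota /=.
move=> /andP[/andP[/and4P[hz lx ly lz] /and3P[rx ry rz]] /andP[hx hy]].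
split; [lia| |right; lia|split; first exact: folded_set0].
  by split; apply: folded_set_low.
have -> : N%:Z + 1 - (x + y).+1%:Z = (N - (x + y))%N%:Z by lia.
exact: folded_set_low.
Qed.

Lemma UUL_count : (size [seq p <- Sq | UUL l H N p.1 p.2
    && avoids p.1 p.2 (N - (p.1 + p.2 + 1))] <= pair_energy N J)%N.
Proof.
apply: (@pair_energy_ge _ _ _
  (fun p => (N%:Z - p.1%:Z, (N - (p.1 + p.2 + 1))%N%:Z)) (fun p => p.2.+1)).
- by rewrite filter_uniq // uniq_pairs ?iota_uniq.
- move=> [x y] [x' y']; rewrite !mem_filter /UUL /=.
  move=> /andP[/andP[/and4P[hz _ _ _] _] _] /andP[/andP[/and4P[hz' _ _ _] _] _].
  by case=> *; congr pair; lia.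
move=> [x y]; rewrite mem_filter mem_pairs !mem_iota /=.
move=> /andP[/andP[/and4P[hz nx ny lz] /and3P[rx ry rz]] /andP[hx hy]].
split; [lia| |left; lia|split; first exact: folded_set0].
  split; last exact: folded_set_low.
  by apply: folded_set_high; rewrite // 1?eq_sym //; lia.
have -> : N%:Z + 1 - y.+1%:Z = N%:Z - y%:Z by lia.
by apply: folded_set_high; rewrite // 1?eq_sym //; lia.
Qed.

(** Five patterns cost one energy each. Pairs whose triple meets [r] lie on six lines: [x = r],
    [y = r], and [z = r] for the four formulas for [z]. *)
Lemma closing_pairs_count :
  (size (closing_pairs l H N) <= 6 * H + 5 * pair_energy N J)%N.
Proof.
pose I := iota 1 H.
(* [R] contains the closing pairs whose triple involves r. *)
pose R : seq (nat * nat) := ([seq (r, y) | y <- I] ++ [seq (x, r) | x <- I]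
  ++ [seq (x, r - (x + 1)) | x <- I] ++ [seq (x, r - x) | x <- I]
  ++ [seq (x, N - (x + r)) | x <- I] ++ [seq (x, N - (x + r + 1)) | x <- I])%N.
have sR : size R = (6 * H)%N by rewrite !size_cat !size_map size_iota; lia.
have := UUU_count; have := LLU_count; have := LUL_count.
have := LLL_count; have := UUL_count.
set S5 := filter _ _; set S4 := filter _ _; set S3 := filter _ _.
set S2 := filter _ _; set S1 := filter _ _ => h5 h4 h3 h2 h1.
suff : (size (closing_pairs l H N) <=
        size (R ++ S1 ++ S2 ++ S3 ++ S4 ++ S5))%N.
  by rewrite size_cat sR !size_cat; lia.
apply: uniq_leq_size; first by rewrite filter_uniq ?uniq_pairs ?iota_uniq.
move=> [x y]; rewrite mem_filter => /andP[/and3P[/= hx hy hc] hS].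
have hI z : (0 < z <= H)%N -> z \in I by rewrite mem_iota; lia.
rewrite mem_cat; case: (boolP (_ \in R)) => //= nR.
have [rx ry] : r != x /\ r != y.
  split; apply: contraNneq nR => e; rewrite !mem_cat.
    by rewrite e map_f ?hI.
  by rewrite e (map_f (fun x => (x, y))) ?hI ?orbT.
rewrite !mem_cat !mem_filter hS /avoids rx ry /= !andbT.
have n1 : r != (x + y + 1)%N.
  apply: contraNneq nR => e; have -> : (x, y) = (x, r - (x + 1))%N.
    by congr pair; lia.
  by rewrite !mem_cat (map_f (fun x => (x, r - (x + 1))%N)) ?hI ?orbT.
have n2 : r != (x + y)%N.
  apply: contraNneq nR => e; have -> : (x, y) = (x, r - x)%N.
    by congr pair; lia.
  by rewrite !mem_cat (map_f (fun x => (x, r - x)%N)) ?hI ?orbT.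
have n3 : (0 < N - (x + y))%N -> r != (N - (x + y))%N.
  move=> hz; apply: contraNneq nR => e; have -> : (x, y) = (x, N - (x + r))%N.
    by congr pair; lia.
  by rewrite !mem_cat (map_f (fun x => (x, N - (x + r))%N)) ?hI ?orbT.
have n4 : (0 < N - (x + y + 1))%N -> r != (N - (x + y + 1))%N.
  move=> hz; apply: contraNneq nR => e.
  have -> : (x, y) = (x, N - (x + r + 1))%N by congr pair; lia.
  by rewrite !mem_cat (map_f (fun x => (x, N - (x + r + 1))%N)) ?hI ?orbT.
rewrite n1 n2 !andbT.
case/or4P: hc => [->|->|->|/orP[]h]; rewrite ?orbT //.
  by rewrite h n3 ?orbT //; case/andP: h => /andP[].
by rewrite h n4 ?orbT //; case/andP: h => /andP[].
Qed.
End Folded.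

Theorem theorem7p9 (R : realType) :
  exists (c : R) (H0 : nat), 0 < c /\
    forall (H eps r : nat) (L U : {fset nat}),
      (H0 <= H)%N ->
      eps = 1%N \/ eps = 2%N ->
      (1 <= r <= H)%N ->
      [disjoint L & U] ->
      L `|` U = [fset k in iota 1 H | k != r] ->
      let N := (2 * H + eps)%N in
      c * H%:R ^+ 2 <= (pair_energy N (folded_set N L U))%:R.
Proof.
exists (1000 * 1000)%:R^-1, (1000 * 1000)%N; split.
  by rewrite invr_gt0 ltr0n.
move=> H eps r L U hH heps _ _ hU; set N := (2 * H + eps)%N; cbv zeta.
have hN : (2 * H < N)%N by rewrite /N; lia.
have hN2 : (N <= 2 * H + 2)%N by rewrite /N; lia.
rewrite ler_pdivrMl ?ltr0n // -natrX -natrM ler_nat.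
have h1 := closing_pairs_count hN hU.
have h2 : ((H %/ 24) * (H %/ 24) <=
    100 * size (closing_pairs (fun x => x \in L) H N))%N.
  by apply: many_closing_pairs => //; lia.
move: (pair_energy _ _) (size _) h1 h2 => P g h1 h2.
have [M eM] : exists M, M = (H %/ 24)%N by exists (H %/ 24)%N.
rewrite -eM in h2.
(* Combining [h1] and [h2], [M * M <= 600 * H + 500 * P]. For such [M] the term
   [600 * H <= 15000 * M] is at most half of [M * M], so [M * M <= 1000 * P] and
   [H * H <= 625 * 1000 * P]. *)
have hM : (30 * 1000 <= M)%N by lia.
have hHM : (H <= 25 * M)%N by lia.
have h3 : (H * H <= 25 * M * (25 * M))%N by apply: leq_mul.
have h4 : (30 * 1000 * M <= M * M)%N by rewrite leq_mul2r hM orbT.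
rewrite expnS expn1.
lia.
Qed.
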